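(* When the infinity norm is chosen as the norm in the solution space $G=\mathbb R^k$, the condition number $\kappa_\infty$ of $g(A,b)=L^{\top}(A^{\top}\Sigma_{pq}A)^{-1}A^{\top}\Sigma_{pq}b$ at $(A,b)$ (componentwise norm on the data) is $$\kappa_\infty=\big\|\,|L^{\top}V|\,\mathrm{vec}(|A|)+|L^{\top}W|\,|b|\,\big\|_\infty .$$
   Context: Let $m\ge n$, $p+q=m$, $\Sigma_{pq}=\begin{pmatrix} I_p&0\\0&-I_q\end{pmatrix}$, $A=(a_{ij})\in\mathbb R^{m\times n}$, $b\in\mathbb R^m$, with $A^{\top}\Sigma_{pq}A$ positive definite (standing assumption). Let $x=(A^{\top}\Sigma_{pq}A)^{-1}A^{\top}\Sigma_{pq}b$ be the solution of the indefinite least squares problem $\min_x(b-Ax)^{\top}\Sigma_{pq}(b-Ax)$, and $r=b-Ax$. Let $L\in\mathbb R^{n\times k}$, $k\le n$, be a fixed matrix, and $g(A,b)=L^{\top}(A^{\top}\Sigma_{pq}A)^{-1}A^{\top}\Sigma_{pq}b\in\mathbb R^k$, which is Fréchet differentiable near $(A,b)$, with derivative $g'(A,b)$. On the data space the componentwise norm relative to $(A,b)$ is used: $\|(\Delta A,\Delta b)\|_c=\min\{\omega\ge0:\ |\Delta a_{ij}|\le\omega|a_{ij}|,\ |\Delta b_i|\le\omega|b_i|\ \text{for all } i,j\}$ (equal to $+\infty$ if no such $\omega$ exists). Then $\kappa_\infty=\max_{\|(\Delta A,\Delta b)\|_c=1}\|g'(A,b)\cdot(\Delta A,\Delta b)\|_\infty$.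 Define $W=(A^{\top}\Sigma_{pq}A)^{-1}A^{\top}\Sigma_{pq}$ and $V=(A^{\top}\Sigma_{pq}A)^{-1}\otimes(\Sigma_{pq}r)^{\top}-x^{\top}\otimes W$, where $\otimes$ is the Kronecker product. $\mathrm{vec}$ stacks the columns of a matrix, and $|\cdot|$ of a matrix or vector is taken entrywise. *)

(* Defs.v *)
From mathcomp Require Import all_boot all_order all_algebra.
From mathcomp Require Import all_classical all_reals all_analysis.
From mathcomp Require Import mxtens.

Set Implicit Arguments.
Unset Strict Implicit.
Unset Printing Implicit Defensive.

Import Order.TTheory GRing.Theory Num.Theory.
Import numFieldNormedType.Exports.

Local Open Scope classical_set_scope.
Local Open Scope ring_scope.

Section MatrixNotions.
Context {R : realType}.

Definition absmx m n (M : 'M[R]_(m, n)) : 'M[R]_(m, n) := map_mx Num.norm M.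

(* Column stacking.  [mxvec] of the library stacks rows; the index decoding
   below is the one used for the Kronecker product [_ *t _], see [vecE]. *)
Definition vec m n (M : 'M[R]_(m, n)) : 'cV[R]_(n * m) :=
  \col_l M (mxtens_unindex l).2 (mxtens_unindex l).1.

Lemma vecE m n (M : 'M[R]_(m, n)) (i : 'I_m) (j : 'I_n) :
  vec M (mxtens_index (j, i)) 0 = M i j.
Proof. by rewrite mxE mxtens_indexK. Qed.

Definition posdefmx n (M : 'M[R]_n) : Prop :=
  M^T = M /\ forall v : 'cV[R]_n, v != 0 -> 0 < (v^T *m M *m v) 0 0.

Definition is_max (S : set R) (v : R) : Prop := S v /\ ubound S v.

End MatrixNotions.

Section ComponentwiseConditionNumber.
Context {R : realType} {m n k : nat}.
Implicit Types P D : 'M[R]_(m, n) * 'cV[R]_m.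

Definition cnorm_bounds P D : set R :=
  [set w | [/\ 0 <= w,
               forall i j, `|D.1 i j| <= w * `|P.1 i j| &
               forall i, `|D.2 i 0| <= w * `|P.2 i 0|]].

(* The infimum is [+oo] when there is no admissible bound, and is a minimum
   otherwise, see [cnorm_min]. *)
Definition cnorm P D : \bar R := ereal_inf (EFin @` cnorm_bounds P D).

Lemma cnorm_min P D : cnorm_bounds P D !=set0 ->
  exists2 w, cnorm_bounds P D w & cnorm P D = w%:E.
Proof.
set S := cnorm_bounds P D => S0.
have lS : has_lbound S by exists 0 => w [].
have hS : has_inf S by [].
have key (d a : R) : (forall w, S w -> `|d| <= w * `|a|) ->
    `|d| <= inf S * `|a|.
  move=> H; have [a0|a0] := eqVneq a 0.
    by have [w /H] := S0; rewrite a0 normr0 !mulr0.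
  rewrite -ler_pdivrMr ?normr_gt0//; apply: lb_le_inf => // w Sw.
  by rewrite ler_pdivrMr ?normr_gt0// H.
exists (inf S); last by rewrite /cnorm ereal_inf_EFin.
split; first by apply: lb_le_inf => // w [].
- by move=> i j; apply: key => w [].
- by move=> i; apply: key => w [].
Qed.

(* [`|_|] on matrices is the largest absolute value of the entries, so it is
   the infinity norm on column vectors.  Differentiability is that of Frechet
   (for the max norm on the data space, all norms being equivalent there). *)
Definition is_cond_infty (f : 'M[R]_(m, n) * 'cV[R]_m -> 'cV[R]_k) P
    (kappa : R) : Prop :=
  differentiable f P /\
  is_max [set `|'d f P D| | D in [set D | cnorm P D = 1%E]] kappa.

End ComponentwiseConditionNumber.

Section IndefiniteLeastSquares.
Context {R : realType} {p q n : nat}.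
Implicit Types (A : 'M[R]_(p + q, n)) (b : 'cV[R]_(p + q)).

Definition Sigma : 'M[R]_(p + q) := block_mx 1%:M 0 0 (- 1%:M).

Definition ils_gram A : 'M[R]_n := A^T *m Sigma *m A.

Definition ils_W A : 'M[R]_(n, p + q) := invmx (ils_gram A) *m A^T *m Sigma.

Definition ils_sol A b : 'cV[R]_n := ils_W A *m b.

Definition ils_res A b : 'cV[R]_(p + q) := b - A *m ils_sol A b.

(* The casts identify the row dimensions [n * 1] and [1 * n] with [n]. *)
Definition ils_V A b : 'M[R]_(n, n * (p + q)) :=
  castmx (muln1 n, erefl) (invmx (ils_gram A) *t (Sigma *m ils_res A b)^T)
  - castmx (mul1n n, erefl) ((ils_sol A b)^T *t ils_W A).

Definition ils_g k (L : 'M[R]_(n, k))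
    (P : 'M[R]_(p + q, n) * 'cV[R]_(p + q)) : 'cV[R]_k :=
  L^T *m invmx (P.1^T *m Sigma *m P.1) *m P.1^T *m Sigma *m P.2.

End IndefiniteLeastSquares.

(* Main.v *)
Require Import Defs.
From mathcomp Require Import all_boot all_order all_algebra.
From mathcomp Require Import all_classical all_reals all_analysis.
From mathcomp Require Import mxtens.

(* The increment of the solution satisfies the exact identity
     x' - x = G'^-1 ((A' - A)^T S r + A'^T S ((b' - b) - (A' - A) x)),
   where G' = A'^T S A' and S = Sigma, because A^T S r = 0.  Along a line
   through (A, b) the data increments carry a factor h, so the directional
   derivative follows from the continuity of G'^-1 alone; differentiability of
   the inverse comes from Cramer's rule.  Hence the derivative is
   M = [L^T V, L^T W] applied to (vec dA, db).  Over the box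
   |(vec dA, db)| <= |(vec A, b)| the max norm of M d is largest at a vertex
   whose signs are those of the dominating row of M. *)

Import Order.TTheory GRing.Theory Num.Theory.
Import numFieldNormedType.Exports.
Local Open Scope ring_scope.

(** * Differentiability of matrix-valued maps, up to the inverse *)

Section Differentiability.
Context {R : realType} {U : normedModType R}.

(** The first-order expansion of [f] at [x] is also one of [g], since the two remainders agree near
    0. This allows [invmx] to be replaced by Cramer's formula, with which it agrees at invertible
    matrices. *)
Lemma near_eq_differentiable (W : normedModType R) (f g : U -> W) x :
  (\forall y \near x, f y = g y) -> differentiable f x -> differentiable g x.
Proof.
move=> fg df; have fgx : f x = g x by exact: nbhs_singleton fg.
have [dfc /eqaddoP dfo] := (diff_locallyP _ _).1 df.
have dg : g \o shift x = cst (g x) + 'd f x +o_ 0 id.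
  apply/eqaddoP => e e0; near=> h.
  suff <- : (f \o shift x - (cst (f x) + 'd f x)) h =
            (g \o shift x - (cst (g x) + 'd f x)) h.
    by near: h; exact: dfo.
  rewrite !fctE fgx; congr (_ - _).
  by near: h; have := fg; rewrite (near_shift 0) subr0.
by apply/diff_locallyP; rewrite (diff_unique dfc dg).
Unshelve. all: by end_near. Qed.

Lemma differentiable_fst (V W : normedModType R) (z : V * W) :
  differentiable (@fst V W) z.
Proof. by apply: linear_differentiable => y; exact: cvg_fst. Qed.

Lemma differentiable_snd (V W : normedModType R) (z : V * W) :
  differentiable (@snd V W) z.
Proof. by apply: linear_differentiable => y; exact: cvg_snd. Qed.

Lemma differentiable_sumr (W : normedModType R) I r (P : pred I)
    (f : I -> U -> W) x :
  (forall i, P i -> differentiable (f i) x) ->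
  differentiable (fun y => \sum_(i <- r | P i) f i y) x.
Proof.
move=> df; rewrite -fct_sumE; elim/big_ind : _ => //.
by move=> g h; exact: differentiableD.
Qed.

Lemma differentiable_prodr I r (P : pred I) (f : I -> U -> R) x :
  (forall i, P i -> differentiable (f i) x) ->
  differentiable (fun y => \prod_(i <- r | P i) f i y) x.
Proof.
move=> df; rewrite -fct_prodE; elim/big_ind : _ => //.
by move=> g h; exact: differentiableM.
Qed.

Lemma differentiable_mx m n (M : U -> 'M[R]_(m, n)) x :
  (forall i j, differentiable (fun y => M y i j) x) -> differentiable M x.
Proof.
move=> dM; rewrite (_ : M = fun y => \sum_i \sum_j M y i j *: delta_mx i j).
  apply: differentiable_sumr => i _; apply: differentiable_sumr => j _.
  exact: differentiableZl.
by apply/funext => y; rewrite -matrix_sum_delta.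
Qed.

Lemma differentiable_entry m n (M : U -> 'M[R]_(m, n)) x i j :
  differentiable M x -> differentiable (fun y => M y i j) x.
Proof.
by move=> dM; exact: differentiable_comp dM (differentiable_coord _ i j).
Qed.

Lemma differentiable_trmx m n (M : U -> 'M[R]_(m, n)) x :
  differentiable M x -> differentiable (fun y => (M y)^T) x.
Proof.
move=> dM; apply: differentiable_mx => i j.
rewrite (_ : (fun _ => _) = (fun y => M y j i)).
  exact: differentiable_entry.
by apply/funext => y; rewrite mxE.
Qed.

Lemma differentiable_mulmx m n p (M : U -> 'M[R]_(m, n))
    (N : U -> 'M[R]_(n, p)) x :
  differentiable M x -> differentiable N x ->
  differentiable (fun y => M y *m N y) x.
Proof.
move=> dM dN; apply: differentiable_mx => i j.
rewrite (_ : (fun _ => _) = (fun y => \sum_l M y i l * N y l j)); last first.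
  by apply/funext => y; rewrite mxE.
by apply: differentiable_sumr => l _; apply: differentiableM;
  exact: differentiable_entry.
Qed.

Lemma differentiable_det n (M : U -> 'M[R]_n) x :
  differentiable M x -> differentiable (fun y => \det (M y)) x.
Proof.
(* The determinant is unfolded to the Leibniz sum over permutations. *)
move=> dM; apply: differentiable_sumr => s _; apply: differentiableM.
  exact: differentiable_cst.
by apply: differentiable_prodr => i _; exact: differentiable_entry.
Qed.

Lemma differentiable_adj n (M : U -> 'M[R]_n) x :
  differentiable M x -> differentiable (fun y => \adj (M y)) x.
Proof.
move=> dM; apply: differentiable_mx => i j.
rewrite (_ : (fun _ => _) = (fun y => cofactor (M y) j i)); last first.
  by apply/funext => y; rewrite mxE.
apply: differentiableM; first exact: differentiable_cst.
apply: differentiable_det; apply: differentiable_mx => k l.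
rewrite (_ : (fun _ => _) = (fun y => M y (lift j k) (lift i l))).
  exact: differentiable_entry.
by apply/funext => y; rewrite !mxE.
Qed.

Lemma near_unitmx n (M : U -> 'M[R]_n) x :
  differentiable M x -> M x \in unitmx -> \forall y \near x, M y \in unitmx.
Proof.
move=> dM; rewrite unitmxE unitfE => Mx0.
have /differentiable_continuous dc := differentiable_det _ _ _ dM.
by near=> y; rewrite unitmxE unitfE; near: y; exact: cvgr_neq0 dc Mx0.
Unshelve. all: by end_near. Qed.

Lemma differentiable_invmx n (M : U -> 'M[R]_n) x :
  differentiable M x -> M x \in unitmx ->
  differentiable (fun y => invmx (M y)) x.
Proof.
move=> dM Mxu.
(* At a singular matrix [invmx] returns its argument, so Cramer's formula is only used near [x],
   where the determinant stays nonzero. *)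
apply: (near_eq_differentiable _ (fun y => (\det (M y))^-1 *: \adj (M y))).
  near=> y; have Mu : M y \in unitmx by near: y; exact: near_unitmx.
  by rewrite /invmx Mu.
apply: differentiable_mx => i j.
rewrite (_ : (fun _ => _) =
             (fun y => (\det (M y))^-1 * \adj (M y) i j)); last first.
  by apply/funext => y; rewrite mxE.
apply: differentiableM; last exact/differentiable_entry/differentiable_adj.
apply: differentiableV; first exact: differentiable_det.
by rewrite -unitfE -unitmxE.
Unshelve. all: by end_near. Qed.

End Differentiability.

(** * Maximum of the max norm of a linear image over a box *)

Section MaxNorm.
Context {R : realType}.

Lemma ler_mx_norm m n (M : 'M[R]_(m, n)) i j : `|M i j| <= `|M|.
Proof. by rewrite [leRHS]/Num.norm/= mx_normrE (le_bigmax _ _ (i, j)). Qed.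

Lemma mx_norm_ler m n (M : 'M[R]_(m, n)) (c : R) :
  0 <= c -> (forall i j, `|M i j| <= c) -> `|M| <= c.
Proof.
by move=> c0 Mc; rewrite [leLHS]/Num.norm/= mx_normrE; apply: bigmax_le.
Qed.

Lemma absmx_mulmx_ge0 k n (M : 'M[R]_(k, n)) (a : 'cV[R]_n) i :
  0 <= (absmx M *m absmx a) i 0.
Proof. by rewrite mxE sumr_ge0// => l _; rewrite !mxE mulr_ge0. Qed.

Lemma ler_norm_mulmx k n (M : 'M[R]_(k, n)) (a d : 'cV[R]_n) :
  (forall l, `|d l 0| <= `|a l 0|) -> `|M *m d| <= `|absmx M *m absmx a|.
Proof.
move=> da; apply: mx_norm_ler => // i j; rewrite ord1.
apply: le_trans (ler_mx_norm _ _ _ i 0).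
rewrite (ger0_norm (absmx_mulmx_ge0 _ _ _ _ _)).
rewrite !mxE (le_trans (ler_norm_sum _ _ _))// ler_sum// => l _.
by rewrite !mxE normrM ler_wpM2l.
Qed.

Lemma norm_mulmx_attained k n (M : 'M[R]_(k, n)) (a : 'cV[R]_n) :
  exists2 d : 'cV[R]_n, (forall l, `|d l 0| = `|a l 0|) &
    `|M *m d| = `|absmx M *m absmx a|.
Proof.
have [K0|] := eqVneq `|absmx M *m absmx a| 0.
  exists a => //; apply/eqP; rewrite K0 eq_le normr_ge0 andbT -K0.
  exact: ler_norm_mulmx.
(* A nonzero max norm is attained at some entry; [i] is the dominating row. *)
move=> /mx_norm_neq0[[i j]]; rewrite [j]ord1 -/(Num.norm _) => Ki.
(* The signs make [M i l * d l 0] equal to [|M i l * a l 0|], so nothing cancels in row [i]. A zero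
   product gets sign +1, which keeps [|d l 0| = |a l 0|] for every [l]. *)
pose d : 'cV[R]_n := \col_l ((-1) ^+ (M i l * a l 0 < 0)%R * a l 0).
have dE l : `|d l 0| = `|a l 0| by rewrite mxE normrMsign.
exists d => //; apply/eqP.
rewrite eq_le ler_norm_mulmx ?andbT => [|l]; last by rewrite dE.
rewrite [leLHS]Ki /= (ger0_norm (absmx_mulmx_ge0 _ _ _ _ _)).
apply: le_trans (ler_mx_norm _ _ _ i 0); apply: le_trans (ler_norm _).
rewrite !mxE le_eqVlt; apply/orP; left; apply/eqP/eq_bigr => l _.
by rewrite !mxE mulrCA -normrM normrEsign.
Qed.

End MaxNorm.

(** * Kronecker products acting on stacked matrices *)

Section Vec.
Context {R : realType}.

Lemma mulmx_vecE k m n (M : 'M[R]_(k, n * m)) (D : 'M[R]_(m, n)) i :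
  (M *m vec D) i 0 = \sum_j \sum_l M i (mxtens_index (j, l)) * D l j.
Proof.
rewrite mxE pair_big (reindex (@mxtens_index n m)) /=.
  by apply: eq_bigr => -[j l] _; rewrite vecE.
by exists (@mxtens_unindex n m) => ? _;
  rewrite (mxtens_indexK, mxtens_unindexK).
Qed.

(** Case [B = u^T] of the identity [(M *t B) vec D = vec (B D M^T)]; the row [u^T D M^T] is stacked
    into its transpose. *)
Lemma tensmx_row_vec k m n (M : 'M[R]_(k, n)) (u : 'cV[R]_m)
    (D : 'M[R]_(m, n)) :
  castmx (muln1 k, erefl) (M *t u^T) *m vec D = M *m D^T *m u.
Proof.
apply/matrixP => i j; rewrite ord1 mulmx_vecE -mulmxA [RHS]mxE.
apply: eq_bigr => l _; rewrite mxE mulr_sumr; apply: eq_bigr => h _.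
rewrite castmxE cast_ord_id.
(* The pair [(i, 0)] is encoded as [i * 1 + 0], the value that the cast preserves. *)
rewrite (_ : cast_ord _ _ = mxtens_index (i, ord0)); last first.
  by apply: val_inj; rewrite /= muln1 addn0.
by rewrite tensmxE !mxE -mulrA [u _ _ * _]mulrC.
Qed.

(** The same identity with a row as left factor: [W D x] is already a column, so stacking does not
    change it. *)
Lemma tensmx_col_vec k m n (x : 'cV[R]_n) (W : 'M[R]_(k, m))
    (D : 'M[R]_(m, n)) :
  castmx (mul1n k, erefl) (x^T *t W) *m vec D = W *m D *m x.
Proof.
apply/matrixP => i j; rewrite ord1 mulmx_vecE [RHS]mxE.
apply: eq_bigr => l _; rewrite mxE mulr_suml; apply: eq_bigr => h _.
rewrite castmxE cast_ord_id.
rewrite (_ : cast_ord _ _ = mxtens_index (0, i)); last first.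
  by apply: val_inj; rewrite /= mul0n add0n.
by rewrite tensmxE !mxE [x l _ * _]mulrC mulrAC.
Qed.

Lemma absmx_vec m n (M : 'M[R]_(m, n)) : vec (absmx M) = absmx (vec M).
Proof. by apply/matrixP => i j; rewrite !mxE. Qed.

Lemma absmx_row k m n (M : 'M[R]_(k, m)) (N : 'M[R]_(k, n)) :
  absmx (row_mx M N) = row_mx (absmx M) (absmx N).
Proof. exact: map_row_mx. Qed.

Lemma absmx_col k m n (M : 'M[R]_(m, k)) (N : 'M[R]_(n, k)) :
  absmx (col_mx M N) = col_mx (absmx M) (absmx N).
Proof. exact: map_col_mx. Qed.

(** Turns an extremal column back into a perturbation of the data. *)
Lemma col_mx_vec_surj m n (d : 'cV[R]_(n * m + m)) :
  exists D : 'M[R]_(m, n) * 'cV[R]_m, col_mx (vec D.1) D.2 = d.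
Proof.
exists (\matrix_(i, j) d (lshift _ (mxtens_index (j, i))) 0, dsubmx d) => /=.
rewrite -[RHS]vsubmxK; congr col_mx; apply/matrixP => i j.
by rewrite ord1; case: (mxtens_indexP i) => a b; rewrite vecE !mxE.
Qed.

Lemma col_mx_vec_le m n (D P : 'M[R]_(m, n) * 'cV[R]_m) l :
  cnorm_bounds P D 1 ->
  `|col_mx (vec D.1) D.2 l 0| <= `|col_mx (vec P.1) P.2 l 0|.
Proof.
move=> [_ D1 D2]; rewrite !mxE; case: fintype.split => i.
  by case: (mxtens_indexP i) => j h; rewrite !vecE -[leRHS]mul1r.
by rewrite -[leRHS]mul1r.
Qed.

End Vec.

(** * The unit sphere of the componentwise norm *)

Section ComponentwiseNorm.
Context {R : realType} {m n : nat}.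
Implicit Types P D : 'M[R]_(m, n) * 'cV[R]_m.

(** An empty set of bounds would give the value [+oo]; otherwise the infimum, here 1, is itself an
    admissible bound. *)
Lemma cnorm1_bounds P D : cnorm P D = 1%E -> cnorm_bounds P D 1.
Proof.
move=> D1; have [D0|/set0P/cnorm_min[w Dw]] := eqVneq (cnorm_bounds P D) set0.
  by move: D1; rewrite /cnorm D0 image_set0 ereal_inf0.
by rewrite D1 => -[->].
Qed.

(** Equal moduli make 1 admissible, and a nonzero entry of [P.1] forces every admissible bound to be
    at least 1. *)
Lemma cnorm_eq1 P D : P.1 != 0 ->
  (forall l, `|col_mx (vec D.1) D.2 l 0| = `|col_mx (vec P.1) P.2 l 0|) ->
  cnorm P D = 1%E.
Proof.
move=> /matrix0Pn[i0 [j0 P0]] DP.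
have DP1 i j : `|D.1 i j| = `|P.1 i j|.
  by have := DP (lshift _ (mxtens_index (j, i))); rewrite !col_mxEu !vecE.
have DP2 i : `|D.2 i 0| = `|P.2 i 0|.
  by have := DP (rshift _ i); rewrite !col_mxEd.
apply/eqP; rewrite eq_le; apply/andP; split.
  apply: ereal_inf_lbound; exists 1 => //.
  by split=> // [i j|i]; rewrite mul1r ?DP1 ?DP2.
apply: le_ereal_inf_tmp => _ [w [_ /(_ i0 j0) + _] <-].
by rewrite DP1 -{1}[`|P.1 i0 j0|]mul1r ler_pM2r ?normr_gt0// lee_fin.
Qed.

End ComponentwiseNorm.

(** * Perturbation identity and derivative of the solution *)

Section IndefiniteLeastSquares.
Local Open Scope classical_set_scope.
Local Open Scope ring_scope.
Context {R : realType} {p q n : nat}.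
Implicit Types (A : 'M[R]_(p + q, n)) (b : 'cV[R]_(p + q)).
Local Notation S := (@Sigma R p q).
Local Notation data := ('M[R]_(p + q, n) * 'cV[R]_(p + q))%type.

Lemma posdefmx_unit m (M : 'M[R]_m) : posdefmx M -> M \in unitmx.
Proof.
move=> [_ Mpos]; rewrite unitmxE unitfE; apply/negP => /det0P[v v0 vM].
have vT : v^T != 0 by apply: contraNneq v0 => vT; rewrite -[v]trmxK vT trmx0.
by have := Mpos _ vT; rewrite trmxK vM mul0mx mxE ltxx.
Qed.

Lemma posdef_gram_neq0 A : (0 < n)%N -> posdefmx (ils_gram A) -> A != 0.
Proof.
(* For [A = 0] the form vanishes at the all-ones vector, which is nonzero because [n] is
   positive. *)
move=> n0 [_ /(_ (const_mx 1))]; apply: contraPneq => -> H.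
have : const_mx 1 != 0 :> 'cV[R]_n.
  apply/eqP => /matrixP/(_ (Ordinal n0) 0).
  by rewrite !mxE; apply/eqP/oner_neq0.
by move=> /H; rewrite /ils_gram !(mulmx0, mul0mx) mxE ltxx.
Qed.

Lemma ils_gram_sol A b : ils_gram A \in unitmx ->
  ils_gram A *m ils_sol A b = A^T *m S *m b.
Proof.
move=> Au; rewrite -[RHS](mulKVmx Au); congr (_ *m _).
by rewrite /ils_sol /ils_W !mulmxA.
Qed.

Lemma ils_normal_eq A b : ils_gram A \in unitmx ->
  A^T *m S *m ils_res A b = 0.
Proof.
move=> Au; rewrite /ils_res mulmxBr [X in _ - X]mulmxA.
by rewrite -[A^T *m S *m A]/(ils_gram A) ils_gram_sol ?subrr.
Qed.

Lemma ils_gE k (L : 'M[R]_(n, k)) (P : data) :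
  ils_g L P = L^T *m ils_sol P.1 P.2.
Proof. by rewrite /ils_g /ils_sol /ils_W /ils_gram !mulmxA. Qed.

(** Multiplied by [ils_gram A'], both sides become [A'^T S (b' - A' x)]: the left by the normal
    equations at [(A', b')], the right because [A^T S r = 0]. *)
Lemma ils_sol_perturb A A' b b' :
  ils_gram A \in unitmx -> ils_gram A' \in unitmx ->
  ils_sol A' b' - ils_sol A b =
  invmx (ils_gram A') *m
   ((A' - A)^T *m S *m ils_res A b
    + A'^T *m S *m ((b' - b) - (A' - A) *m ils_sol A b)).
Proof.
move=> Au A'u; set x := ils_sol A b.
rewrite -[LHS](mulKmx A'u); congr (_ *m _).
rewrite [(A' - A)^T]linearB/= !mulmxBl ils_normal_eq// subr0 -mulmxDr mulmxBr.
rewrite ils_gram_sol// -[ils_gram A' *m x]mulmxA -mulmxBr; congr (_ *m _).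
by rewrite /ils_res -/x opprB addrACA [b + _]addrC subrK addKr.
Qed.

Lemma ils_V_vec A b (D : 'M[R]_(p + q, n)) :
  ils_V A b *m vec D =
  invmx (ils_gram A) *m D^T *m S *m ils_res A b - ils_W A *m D *m ils_sol A b.
Proof. by rewrite mulmxBl tensmx_row_vec tensmx_col_vec mulmxA. Qed.

Lemma differentiable_gram (P : data) :
  differentiable (fun Q : data => ils_gram Q.1) P.
Proof.
apply: differentiable_mulmx; last exact: differentiable_fst.
apply: differentiable_mulmx; last exact: differentiable_cst.
exact/differentiable_trmx/differentiable_fst.
Qed.

Lemma differentiable_ils_g k (L : 'M[R]_(n, k)) (P : data) :
  ils_gram P.1 \in unitmx -> differentiable (ils_g L) P.
Proof.
move=> Pu; do 4?[apply: differentiable_mulmx];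
  try exact: differentiable_cst.
- exact: differentiable_invmx (differentiable_gram _) Pu.
- exact/differentiable_trmx/differentiable_fst.
- exact: differentiable_snd.
Qed.

Lemma diff_ils_g k (L : 'M[R]_(n, k)) (P D : data) :
  ils_gram P.1 \in unitmx ->
  'd (ils_g L) P D =
  L^T *m ils_V P.1 P.2 *m vec D.1 + L^T *m ils_W P.1 *m D.2.
Proof.
move=> Pu; rewrite -deriveE; last exact: differentiable_ils_g.
(* By the perturbation identity with the factor [h] cancelled, [phi (h *: D + P)] is exactly the
   difference quotient along [D]. Continuity of [phi] then gives the limit [phi P]. *)
pose phi (Q : data) := L^T *m (invmx (ils_gram Q.1) *m
   (D.1^T *m S *m ils_res P.1 P.2
    + Q.1^T *m S *m (D.2 - D.1 *m ils_sol P.1 P.2))).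
have dphi : differentiable phi P.
  apply: differentiable_mulmx; first exact: differentiable_cst.
  apply: differentiable_mulmx.
    exact: differentiable_invmx (differentiable_gram _) Pu.
  apply: differentiableD; first exact: differentiable_cst.
  apply: differentiable_mulmx; last exact: differentiable_cst.
  apply: differentiable_mulmx; last exact: differentiable_cst.
  exact/differentiable_trmx/differentiable_fst.
have line : h *: D + P @[h --> (0:R)^'] --> P.
  rewrite -[X in _ --> X]add0r -(scale0r D); apply: cvgD; last exact: cvg_cst.
  by apply: cvgZr_tmp; exact: nbhs_dnbhs.
transitivity (phi P); last first.
  rewrite -!mulmxA ils_V_vec -mulmxDr /phi; congr (_ *m _).
  move: (ils_sol P.1 P.2) (ils_res P.1 P.2) => x r.
  by rewrite mulmxDr /ils_W !mulmxBr !mulmxA addrA addrAC.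
rewrite /derive; apply: cvg_lim => //.
apply: cvg_trans (cvg_comp _ _ line (differentiable_continuous dphi)).
apply: near_eq_cvg; near=> h.
have h0 : h != 0 by near: h; exact: nbhs_dnbhs_neq.
(* The identity also needs an invertible Gram matrix at the perturbed point, which holds for small
   [h]. *)
have hu : ils_gram (h *: D + P).1 \in unitmx.
  near: h; suff: \forall y \near P, ils_gram y.1 \in unitmx by exact: line.
  exact: near_unitmx (differentiable_gram P) Pu.
rewrite /= /shift/= !ils_gE -mulmxBr ils_sol_perturb// /phi.
rewrite /= !addrK !scalemxAr; congr (_ *m (_ *m _)).
rewrite linearZ/= -!scalemxAl -scalerBr -!scalemxAr -scalerDr scalerA.
by rewrite mulVf// scale1r.
Unshelve. all: by end_near. Qed.

End IndefiniteLeastSquares.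

Theorem corollary1 (R : realType) (p q n k : nat)
    (A : 'M[R]_(p + q, n)) (b : 'cV[R]_(p + q)) (L : 'M[R]_(n, k))
    (n_gt0 : (0 < n)%N) (le_nm : (n <= p + q)%N) (le_kn : (k <= n)%N)
    (posA : posdefmx (ils_gram A)) :
  is_cond_infty (ils_g L) (A, b)
    `|absmx (L^T *m ils_V A b) *m vec (absmx A)
      + absmx (L^T *m ils_W A) *m absmx b|.
Proof.
have Au := posdefmx_unit _ _ posA.
pose M := row_mx (L^T *m ils_V A b) (L^T *m ils_W A).
have dE (D : 'M[R]_(p + q, n) * 'cV[R]_(p + q)) :
    'd (ils_g L) (A, b) D = M *m col_mx (vec D.1) D.2.
  by rewrite diff_ils_g// mul_row_col.
have -> : absmx (L^T *m ils_V A b) *m vec (absmx A)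
      + absmx (L^T *m ils_W A) *m absmx b = absmx M *m absmx (col_mx (vec A) b).
  by rewrite absmx_row absmx_col mul_row_col absmx_vec.
split; first exact: differentiable_ils_g.
(* Upper bound: data of componentwise norm 1 lie in the box spanned by [(vec A, b)]. *)
split=> [|_ [D /cnorm1_bounds D1 <-]]; last first.
  by rewrite dE; apply: ler_norm_mulmx => l; exact: col_mx_vec_le D1.
(* Attainment: the extremal vertex, read as data, has norm 1 because [A] is nonzero. *)
have [d dA Md] := norm_mulmx_attained _ _ M (col_mx (vec A) b).
have [D DE] := col_mx_vec_surj _ _ d.
exists D; last by rewrite dE DE.
apply: cnorm_eq1; first exact: posdef_gram_neq0.
by move=> l; rewrite DE dA.
Qed.
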